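(* Let $R_q>0$ and $\omega>0$ be positive numbers such that $\Theta^*\in\mathbb{B}_q(R_q)\cap\mathbb{S}$. Let $\hat\Theta$ be a global solution of the optimization problem $\min_{\Theta\in\mathbb{S}}\Psi(\Theta)$. Suppose that $\hat\Gamma$ satisfies the restricted strong convexity and restricted strong smoothness conditions, that is, for some $\alpha_1>0$, $\alpha_2>0$, $\tau>0$ and for all $\Delta\in\mathbb{R}^{d_1\times d_2}$, $$\langle\hat\Gamma\Delta,\Delta\rangle\ge\alpha_1\|\Delta\|_F^2-\tau\|\Delta\|_*^2\quad\text{and}\quad\langle\hat\Gamma\Delta,\Delta\rangle\le\alpha_2\|\Delta\|_F^2+\tau\|\Delta\|_*^2,$$ with $$\tau\le\frac{\phi(\mathbb{Q},\sigma_\epsilon)}{\omega}\sqrt{\frac{\max(d_1,d_2)}{n}}.$$ Let $\{\Theta^t\}_{t=0}^\infty$ be a sequence of iterates with initial point $\Theta^0$ and $v\ge\max\{4\alpha_1,\alpha_2\}$, generated via $$\Theta^{t+1}\in\operatorname*{arg\,min}_{\Theta\in\mathbb{S}}\left\{\frac12\left\|\Theta-\left(\Theta^t-\frac{\nabla\mathcal{L}(\Theta^t)}{v}\right)\right\|_F^2+\frac{\lambda}{v}\|\Theta\|_*\right\}.$$ Assume that $\lambda$ is chosen to satisfy $$\lambda\ge\max\left\{\left(\frac{128\tau R_q}{\alpha_1}\right)^{1/q},\ 4\phi(\mathbb{Q},\sigma_\epsilon)\sqrt{\frac{\max(d_1,d_2)}{n}}\right\}.$$ Then for any tolerance $\delta^*\ge\frac{8\xi}{1-\kappa}\bar\epsilon_{\mathrm{stat}}^2$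 and any iteration $t\ge T(\delta^* )$, $$\|\Theta^t-\hat\Theta\|_F^2\le\frac{4}{\alpha_1}\left(\delta^*+\frac{{\delta^*}^2}{2\tau\omega^2}+2\tau\bar\epsilon_{\mathrm{stat}}^2\right),$$ where $$T(\delta^* )=\log_2\log_2\left(\frac{\omega\lambda}{\delta^*}\right)\left(1+\frac{\log2}{\log(1/\kappa)}\right)+\frac{\log\big((\Psi(\Theta^0)-\Psi(\hat\Theta))/\delta^*\big)}{\log(1/\kappa)}$$ and $$\bar\epsilon_{\mathrm{stat}}=8\lambda^{-\frac q2}R_q^{\frac12}\left(\sqrt2\,\|\hat\Theta-\Theta^*\|_F+\lambda^{1-\frac q2}R_q^{\frac12}\right),$$ $$\kappa=\left\{1-\frac{\alpha_1}{8v}+\frac{256\tau\lambda^{-q}R_q}{\alpha_1}\right\}\left\{1-\frac{256\tau\lambda^{-\frac q2}R_q}{\alpha_1}\right\}^{-1},$$ $$\xi=\tau\left\{\frac{\alpha_1}{8v}+\frac{512\tau\lambda^{\frac q2}R_q}{\alpha_1}+5\right\}\left\{1-\frac{256\tau\lambda^{-\frac q2}R_q}{\alpha_1}\right\}^{-1}.$$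
   Context: Let $d=\min\{d_1,d_2\}$. For $\Theta\in\mathbb{R}^{d_1\times d_2}$ let $\sigma_1(\Theta)\ge\dots\ge\sigma_d(\Theta)\ge0$ be its singular values; $\|\Theta\|_*=\sum_{j=1}^d\sigma_j(\Theta)$ is the nuclear norm, $\|\Theta\|_{\mathrm{op}}=\sigma_1(\Theta)$ the operator norm, $\|\Theta\|_F$ the Frobenius norm, and $\langle\Theta,\Gamma\rangle=\mathrm{trace}(\Theta^\top\Gamma)$. Fix $q\in[0,1]$ and put $\mathbb{B}_q(R_q)=\{\Theta\in\mathbb{R}^{d_1\times d_2}:\sum_{i=1}^d|\sigma_i(\Theta)|^q\le R_q\}$ ($q=0$ corresponds to rank at most $R_0$). For $\omega>0$, $\mathbb{S}=\{\Theta\in\mathbb{R}^{d_1\times d_2}:\|\Theta\|_*\le\omega\}$. The model is $Y=X\Theta^*+\epsilon$ with $n$ samples, $Y\in\mathbb{R}^{n\times d_2}$, $X\in\mathbb{R}^{n\times d_1}$, unknown parameter matrix $\Theta^*\in\mathbb{R}^{d_1\times d_2}$ and observation noise $\epsilon$ with standard deviation $\sigma_\epsilon$. Instead of the rows of $X$ one observes corrupted versions $Z_{i\cdot}\sim\mathbb{Q}(\cdot|X_{i\cdot})$ for a conditional distribution $\mathbb{Q}$. The surrogate matrices $\hat\Gamma\in\mathbb{R}^{d_1\times d_1}$ and $\hat\Upsilon\in\mathbb{R}^{d_1\times d_2}$ are estimates of $X^\top X/n$ and $X^\top Y/n$. The quantity $\phi(\mathbb{Q},\sigma_\epsilon)$,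 depending on the two sources of error $\mathbb{Q}$ and $\sigma_\epsilon$, is the one for which the deviation condition $\|\hat\Upsilon-\hat\Gamma\Theta^*\|_{\mathrm{op}}\le\phi(\mathbb{Q},\sigma_\epsilon)\sqrt{\max(d_1,d_2)/n}$ is required to hold throughout. With regularization parameter $\lambda>0$, define the loss $\mathcal{L}(\Theta)=\frac12\langle\hat\Gamma\Theta,\Theta\rangle-\langle\hat\Upsilon,\Theta\rangle$, whose gradient is $\nabla\mathcal{L}(\Theta)=\hat\Gamma\Theta-\hat\Upsilon$, and the objective $\Psi(\Theta)=\mathcal{L}(\Theta)+\lambda\|\Theta\|_*$; $1/v$ is the step size.
   Formalization: Assumes Θ^0∈S, 0<κ<1 and symmetric Γ̂ (needed for ∇L as given); in T(δ* ) the term log2 log2(ωλ/δ* ) is replaced by its maximum with 0 (0 where undefined), since the printed claim fails for 1<ωλ/δ*<2. For q=0 the first condition on λ is read as 128τR_0/α1≤1. *)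

(* Defs.v *)
From mathcomp Require Import all_boot all_order all_algebra.
From mathcomp Require Import perm complex.
From mathcomp Require Import boolp reals exp.
From mathcomp Require Import ring.

Set Implicit Arguments.
Unset Strict Implicit.
Unset Printing Implicit Defensive.
Import Order.TTheory GRing.Theory Num.Theory.
Local Open Scope ring_scope.

Section SVD.
Variable R : realType.

Definition is_singular_values d1 d2 (A : 'M[R]_(d1, d2)) (s : seq R) : Prop :=
  [/\ size s = minn d1 d2, sorted >=%R s, all (>= 0) s
    & exists (U : 'M[R]_(d1, minn d1 d2)) (V : 'M[R]_(d2, minn d1 d2)),
        [/\ U^T *m U = 1%:M, V^T *m V = 1%:M
          & A = U *m diag_mx (\row_j s`_j) *m V^T]].

Lemma rowdot_ge0 n (x : 'rV[R]_n) : 0 <= (x *m x^T) 0 0.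
Proof. by rewrite mxE sumr_ge0 // => i _; rewrite mxE -expr2 sqr_ge0. Qed.

Lemma rowdot_eq0 n (x : 'rV[R]_n) : ((x *m x^T) 0 0 == 0) = (x == 0).
Proof.
apply/idP/eqP => [|->]; last by rewrite mul0mx mxE.
rewrite mxE psumr_eq0 => [/allP h|i _]; last by rewrite mxE -expr2 sqr_ge0.
apply/rowP => i; rewrite mxE; apply/eqP.
by have := h i (mem_index_enum _); rewrite mxE -expr2 sqrf_eq0.
Qed.

Lemma householder n (u : 'rV[R]_n.+1) : u *m u^T = 1%:M ->
  exists P : 'M[R]_n.+1, P *m P^T = 1%:M /\ row 0 P = u.
Proof.
move=> u1; pose e : 'rV[R]_n.+1 := delta_mx 0 0.
have [->|ue] := eqVneq u e.
  by exists 1%:M; rewrite trmx1 mulmx1 row1.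
have e1 : e *m e^T = 1%:M.
  apply/matrixP => i j; rewrite !ord1 /e trmx_delta mul_delta_mx.
  by rewrite !mxE !eqxx.
pose w := u - e; pose c := (w *m w^T) 0 0.
have c0 : c != 0 by rewrite rowdot_eq0 subr_eq0.
have wwE : w *m w^T = c%:M by rewrite [LHS]mx11_scalar.
pose P := 1%:M - (2 / c) *: (w^T *m w).
have PT : P^T = P.
  by rewrite /P linearB /= trmx1 linearZ /= trmx_mul trmxK.
exists P; split.
  have WW : (w^T *m w) *m (w^T *m w) = c *: (w^T *m w).
    by rewrite mulmxA -(mulmxA w^T) wwE mul_mx_scalar -scalemxAl.
  rewrite PT /P; move: (w^T *m w) WW => W WW.
  rewrite mulmxBl mulmxBr mulmxBr mulmx1 mul1mx -!scalemxAl -!scalemxAr.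
  rewrite mulmx1 WW; apply/matrixP => i j; rewrite !mxE; field.
  exact: c0.
rewrite rowE -/e /P mulmxBr mulmx1 -scalemxAr mulmxA.
have ewE : e *m w^T = (- (c / 2))%:M.
  have ue_eq : u *m e^T = e *m u^T.
    by rewrite -[u *m e^T]trmxK trmx_mul trmxK [_ *m _]mx11_scalar tr_scalar_mx.
  have cE : w *m w^T = 2 *: (1%:M - e *m u^T).
    rewrite /w linearB /= mulmxBl !mulmxBr u1 e1 ue_eq.
    by apply/matrixP => i j; rewrite !mxE; ring.
  rewrite /w linearB /= mulmxBr e1; move: cE; rewrite wwE => /matrixP cE.
  apply/matrixP => i j; have := cE i j; rewrite !ord1 !mxE eqxx !mulr1n => ->.
  by field.
rewrite ewE mul_scalar_mx scalerA.
rewrite (_ : 2 / c * - (c / 2) = -1); last by field.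
by rewrite scaleN1r opprK /w addrC subrK.
Qed.

Lemma sym_eigen n (B : 'M[R]_n) : B^T = B -> B != 0 ->
  exists2 r : R, r != 0 & eigenvalue B r.
Proof.
move=> BT B0; pose C := R[i]; pose f := (real_complex R : {rmorphism R -> C}).
pose A := map_mx f B.
have Areal : A \is a realmx.
  by apply/mxOverP => i j; rewrite mxE /f /= complex_real.
have Aherm : A \is hermsymmx.
  apply: realsym_hermsym => //; apply/is_hermitianmxP.
  by rewrite expr0 scale1r map_mx_id // map_trmx BT.
have Dreal := hermitian_spectral_diag_real Aherm.
have /orthomx_spectralP AE := hermitian_normalmx Aherm.
set D := spectral_diag A in AE Dreal; set P := spectralmx A in AE.
have Pu : P \in unitmx by exact: spectral_unit.
have [i Di] : exists i, D 0 i != 0.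
  apply: contrapT => h.
  have D0 : D = 0.
    apply/rowP => i; rewrite mxE; apply: contrapT => hi; apply: h.
    by exists i; apply/eqP.
  have A0 : A = 0 by rewrite AE D0 linear0 mulmx0 mul0mx.
  by move/eqP: B0; apply; apply/eqP; rewrite -(map_mx_eq0 f); apply/eqP.
have /Creal_ReP ReD : D 0 i \is Num.real by apply/(mxOverP Dreal).
have [r rE] : exists r, D 0 i = f r.
  by move/mxOverP/(_ 0 i): Dreal => /complex_realP [r ->]; exists r.
exists r; first by move: Di; rewrite rE fmorph_eq0.
rewrite eigenvalue_root_char -(fmorph_root f) map_char_poly -/A.
rewrite -eigenvalue_root_char -rE; apply/eigenvalueP.
exists (row i P); last first.
  apply/eqP => /(congr1 (fun x => x *m invmx P)).
  rewrite -row_mul mulmxV // mul0mx => /rowP/(_ i)/eqP.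
  by rewrite !mxE eqxx oner_eq0.
rewrite AE -row_mul !mulmxA mulmxV // mul1mx row_mul row_diag_mx.
by rewrite -scalemxAl -rowE.
Qed.

Lemma sing_pair m n (A : 'M[R]_(m.+1, n.+1)) :
  exists (u : 'rV[R]_m.+1) (v : 'rV[R]_n.+1) (s : R),
    [/\ u *m u^T = 1%:M, v *m v^T = 1%:M, 0 <= s, u *m A = s *: v
      & v *m A^T = s *: u].
Proof.
have [->|A0] := eqVneq A 0.
  exists (delta_mx 0 0), (delta_mx 0 0), 0.
  by split=> //; rewrite ?trmx0 ?mulmx0 ?scale0r //;
    apply/matrixP => i j; rewrite !ord1 trmx_delta mul_delta_mx !mxE !eqxx.
have BT : (A *m A^T)^T = A *m A^T by rewrite trmx_mul trmxK.
have B0 : A *m A^T != 0.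
  apply: contra_neq A0 => /matrixP h; apply/row_matrixP => i.
  rewrite row0; apply/eqP; rewrite -rowdot_eq0.
  have := h i i; rewrite !mxE => h'.
  by apply/eqP; rewrite -[RHS]h'; apply: eq_bigr => j _; rewrite !mxE.
have [r r0 /eigenvalueP [x xB x0]] := sym_eigen BT B0.
pose y := x *m A.
pose c := (x *m x^T) 0 0.
have cE : x *m x^T = c%:M by rewrite [LHS]mx11_scalar.
have c_gt0 : 0 < c by rewrite lt_def rowdot_eq0 x0 rowdot_ge0.
have yy : y *m y^T = (r * c)%:M.
  by rewrite /y trmx_mul mulmxA -(mulmxA x) xB -scalemxAl cE scale_scalar_mx.
have r_gt0 : 0 < r.
  have := rowdot_ge0 y; rewrite yy mxE eqxx mulr1n pmulr_lge0 // => r_ge0.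
  by rewrite lt_def r0.
have sc : Num.sqrt c != 0 by rewrite gt_eqF // sqrtr_gt0.
have sr : Num.sqrt r != 0 by rewrite gt_eqF // sqrtr_gt0.
have cc : Num.sqrt c * Num.sqrt c = c by rewrite -expr2 sqr_sqrtr // ltW.
have rr : Num.sqrt r * Num.sqrt r = r by rewrite -expr2 sqr_sqrtr // ltW.
exists ((Num.sqrt c)^-1 *: x), ((Num.sqrt r * Num.sqrt c)^-1 *: y), (Num.sqrt r).
split; rewrite ?sqrtr_ge0 //.
- rewrite linearZ /= -scalemxAl -scalemxAr cE !scale_scalar_mx -{3}cc.
  by congr (_%:M); field.
- rewrite linearZ /= -scalemxAl -scalemxAr yy !scale_scalar_mx -{3}cc -{3}rr.
  by congr (_%:M); field; rewrite sc sr.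
- by rewrite -scalemxAl scalerA -/y; congr (_ *: _); field; rewrite sc sr.
- rewrite -scalemxAl /y -mulmxA xB !scalerA -{2}rr.
  by congr (_ *: _); field; rewrite sc sr.
Qed.

Lemma svd_unsorted k m n (A : 'M[R]_(m, n)) : minn m n = k ->
  exists (U : 'M[R]_(m, k)) (V : 'M[R]_(n, k)) (s : 'rV[R]_k),
    [/\ U^T *m U = 1%:M, V^T *m V = 1%:M, forall j, 0 <= s 0 j
      & A = U *m diag_mx s *m V^T].
Proof.
elim: k m n A => [|k IH] m n A mn.
  exists 0, 0, 0; split; try by [apply/matrixP => -[] | move=> -[]].
  apply/matrixP => i j; exfalso; move: (leq_ltn_trans (leq0n i) (ltn_ord i)).
  move: (leq_ltn_trans (leq0n j) (ltn_ord j)); move: mn.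
  by case: m {A i} => // m; case: n {j} => // n; rewrite minnSS.
case: m A mn => [|m] A; first by rewrite min0n.
case: n A => [|n] A; first by rewrite minn0.
rewrite minnSS => -[mn].
have [u [v [s [u1 v1 s0 uA vA]]]] := sing_pair A.
have [P [PP P0]] := householder u1; have [Q [QQ Q0]] := householder v1.
have PP' := mulmx1C PP; have QQ' := mulmx1C QQ.
pose B : 'M[R]_(1 + m, 1 + n) := P *m A *m Q^T.
have BD : B = P *m A *m Q^T by [].
have [U [V [t [UU VV t0 BE]]]] := IH _ _ (drsubmx B) mn.
have Br (j : 'I_(1 + n)) : B 0 j = s * (j == 0)%:R.
  have : row 0 B = s *: delta_mx 0 0.
    rewrite /B !row_mul P0 uA -scalemxAl -Q0 -row_mul QQ row1.
    by [].
  by move=> /rowP/(_ j); rewrite !mxE /=.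
have Bc (i : 'I_(1 + m)) : B i 0 = s * (i == 0)%:R.
  have : col 0 B = s *: delta_mx 0 0.
    have -> : col 0 B = P *m (A *m v^T).
      by rewrite /B colE -!mulmxA -colE -tr_row Q0.
    have -> : A *m v^T = s *: u^T by rewrite -[A]trmxK -trmx_mul vA linearZ.
    by rewrite -scalemxAr -P0 tr_row colE mulmxA PP mul1mx.
  by move=> /colP/(_ i); rewrite !mxE /= andbT.
clearbody B.
have l0 a : lshift a (0 : 'I_1) = 0 :> 'I_(1 + a) by exact: val_inj.
have BB : B = block_mx s%:M 0 0 (U *m diag_mx t *m V^T).
  rewrite -[LHS]submxK BE; congr block_mx; apply/matrixP => i j.
  - by rewrite !mxE !ord1 !l0 Br !eqxx mulr1.
  - by rewrite !mxE !ord1 l0 Br mulr0.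
  - by rewrite !mxE !ord1 l0 Bc mulr0.
pose W q (X : 'M[R]_(q, k)) : 'M[R]_(1 + q, 1 + k) := block_mx 1%:M 0 0 X.
have WW q (X : 'M[R]_(q, k)) : X^T *m X = 1%:M -> (W q X)^T *m W q X = 1%:M.
  move=> XX; rewrite tr_block_mx mulmx_block !trmx0 trmx1.
  by rewrite !mulmx0 !mul0mx !addr0 add0r mulmx1 XX -scalar_mx_block.
exists (P^T *m W m U), (Q^T *m W n V), (row_mx s%:M t : 'rV_(1 + k)); split.
- rewrite trmx_mul trmxK -mulmxA (mulmxA P) PP mul1mx; exact: WW.
- rewrite trmx_mul trmxK -mulmxA (mulmxA Q) QQ mul1mx; exact: WW.
- by move=> j; rewrite mxE; case: splitP => l _ //; rewrite ord1 mxE eqxx.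
have -> : A = P^T *m B *m Q.
  by rewrite BD !mulmxA PP' mul1mx -mulmxA QQ' mulmx1.
have {}BB : B = W m U *m diag_mx (row_mx s%:M t) *m (W n V)^T.
  rewrite BB diag_mx_row tr_block_mx !trmx0 trmx1 !mulmx_block.
  rewrite !(mulmx0, mul0mx, addr0, add0r, mul1mx, mulmx1).
  by congr block_mx; apply/matrixP => i j; rewrite !ord1 !mxE eqxx.
by rewrite BB trmx_mul trmxK !mulmxA.
Qed.

Lemma svd_exists m n (A : 'M[R]_(m, n)) : exists s, is_singular_values A s.
Proof.
have [U [V [s [UU VV s0 AE]]]] := svd_unsorted A (erefl (minn m n)).
set k := minn m n in U V s UU VV s0 AE.
pose t := [tuple s 0 i | i < k].
pose t' := sort >=%R t.
have st' : size t' == k by rewrite size_sort size_tuple.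
have : perm_eq (Tuple st') t by rewrite /= perm_sort.
case/tuple_permP => p /= pE.
have tE (i : 'I_k) : t'`_i = s 0 (p i).
  rewrite pE (nth_map i) ?size_enum_ord // nth_ord_enum tnth_map tnth_ord_tuple.
  by [].
exists t'; split.
- exact/eqP.
- by apply: sort_sorted => x y; exact: le_total.
- by apply/allP => x; rewrite mem_sort => /mapP [i _ ->].
have orth q (W : 'M[R]_(q, k)) : W^T *m W = 1%:M ->
    (col_perm p W)^T *m col_perm p W = 1%:M.
  move=> WW; apply/matrixP => i j; have /matrixP/(_ (p i) (p j)) := WW.
  rewrite !mxE (inj_eq perm_inj) => <-.
  by apply: eq_bigr => l _; rewrite !mxE.
exists (col_perm p U), (col_perm p V); split; [exact: orth..|].
rewrite [LHS]AE; apply/matrixP => i j.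
rewrite !mxE (reindex_inj (@perm_inj _ p)) /=; apply: eq_bigr => l _.
by rewrite !mul_mx_diag !mxE tE.
Qed.

End SVD.

Section Norms.
Variables (R : realType) (d1 d2 : nat).
Implicit Types A B : 'M[R]_(d1, d2).

(* [svd_exists] makes the choice legitimate; the sequence is nonincreasing,
   of size min(d1, d2), and (sing_vals A)`_j is sigma_{j+1}(A). *)
Definition sing_vals A : seq R := sval (cid (svd_exists A)).

Lemma sing_valsP A : is_singular_values A (sing_vals A).
Proof. by rewrite /sing_vals; case: cid. Qed.

Definition nuclear_norm A : R := \sum_(j < minn d1 d2) (sing_vals A)`_j.

Definition op_norm A : R := (sing_vals A)`_0.

Definition inner A B : R := \tr (A^T *m B).

Definition frob_norm A : R := Num.sqrt (inner A A).

(* With powR, 0 `^ 0 = 1, so the case q = 0 has to be stated as a rank bound. *)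
Definition schatten_ball (q Rq : R) A : Prop :=
  if q == 0 then (\rank A)%:R <= Rq
  else \sum_(j < minn d1 d2) `|(sing_vals A)`_j| `^ q <= Rq.

Definition nuclear_ball (omega : R) A : Prop := nuclear_norm A <= omega.

Definition is_argmin (S : 'M[R]_(d1, d2) -> Prop) (f : 'M[R]_(d1, d2) -> R) A :=
  S A /\ forall B, S B -> f A <= f B.

End Norms.

Section Objective.
Variables (R : realType) (d1 d2 : nat).
Variables (Gam : 'M[R]_d1) (Ups : 'M[R]_(d1, d2)).
Implicit Types Theta H : 'M[R]_(d1, d2).

Definition loss Theta : R :=
  2^-1 * inner (Gam *m Theta) Theta - inner Ups Theta.

Definition grad_loss Theta : 'M[R]_(d1, d2) := Gam *m Theta - Ups.

(* [grad_loss] is the gradient of [loss] precisely because Gam is symmetric. *)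
Lemma loss_expansion Theta H : Gam^T = Gam ->
  loss (Theta + H)
    = loss Theta + inner (grad_loss Theta) H + 2^-1 * inner (Gam *m H) H.
Proof.
move=> GT.
have innerDl (A B C : 'M[R]_(d1, d2)) :
    inner (A + B) C = inner A C + inner B C.
  by rewrite /inner linearD mulmxDl mxtraceD.
have innerDr (A B C : 'M[R]_(d1, d2)) :
    inner A (B + C) = inner A B + inner A C.
  by rewrite /inner mulmxDr mxtraceD.
have innerNl (A B : 'M[R]_(d1, d2)) : inner (- A) B = - inner A B.
  by rewrite /inner linearN mulNmx linearN.
have sym : inner (Gam *m H) Theta = inner (Gam *m Theta) H.
  by rewrite /inner -[in RHS]mxtrace_tr !trmx_mul !trmxK GT mulmxA.
rewrite /loss /grad_loss mulmxDr !(innerDl, innerDr, innerNl) sym.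
by field.
Qed.

Definition objective (lam : R) Theta : R := loss Theta + lam * nuclear_norm Theta.

Definition prox_objective (lam v : R) (Theta_t Theta : 'M[R]_(d1, d2)) : R :=
  2^-1 * frob_norm (Theta - (Theta_t - v^-1 *: grad_loss Theta_t)) ^+ 2
  + lam / v * nuclear_norm Theta.

Definition restricted_strong_convexity (alpha1 tau : R) : Prop :=
  forall D : 'M[R]_(d1, d2), inner (Gam *m D) D
    >= alpha1 * frob_norm D ^+ 2 - tau * nuclear_norm D ^+ 2.

Definition restricted_strong_smoothness (alpha2 tau : R) : Prop :=
  forall D : 'M[R]_(d1, d2), inner (Gam *m D) D
    <= alpha2 * frob_norm D ^+ 2 + tau * nuclear_norm D ^+ 2.

End Objective.

Section Constants.
Variable R : realType.

(* b ^ (1/q) <= lam; for q = 0 this is the limit q -> 0+ of b <= lam ^ q. *)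
Definition root_le (q b lam : R) : Prop :=
  if q == 0 then b <= 1 else b `^ (q^-1) <= lam.

(* err stands for the Frobenius norm of hat Theta - Theta*. *)
Definition eps_stat (q Rq lam err : R) : R :=
  8 * lam `^ (- (q / 2)) * Num.sqrt Rq
  * (Num.sqrt 2 * err + lam `^ (1 - q / 2) * Num.sqrt Rq).

Definition kappa (q Rq lam tau alpha1 v : R) : R :=
  (1 - alpha1 / (8 * v) + 256 * tau * lam `^ (- q) * Rq / alpha1)
  * (1 - 256 * tau * lam `^ (- (q / 2)) * Rq / alpha1)^-1.

Definition xi (q Rq lam tau alpha1 v : R) : R :=
  tau * (alpha1 / (8 * v) + 512 * tau * lam `^ (q / 2) * Rq / alpha1 + 5)
  * (1 - 256 * tau * lam `^ (- (q / 2)) * Rq / alpha1)^-1.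

Definition log2 (x : R) : R := ln x / ln 2.

(* The double logarithm counts halving epochs, so it is taken to be 0 when
   omega * lam / delta < 2, where log2 (log2 _) is negative or undefined (ln is
   0 on nonpositive reals); for omega * lam / delta >= 2 the max is inert.
   gap stands for Psi(Theta^0) - Psi(hat Theta). *)
Definition iter_bound (omega lam kap gap delta : R) : R :=
  Num.max 0 (log2 (log2 (omega * lam / delta))) * (1 + ln 2 / ln (1 / kap))
  + ln (gap / delta) / ln (1 / kap).

End Constants.

(* Main.v *)
Require Import Defs.
From mathcomp Require Import all_boot all_order all_algebra.
From mathcomp Require Import boolp reals exp.
From mathcomp Require Import ring lra.
Set Implicit Arguments.
Unset Strict Implicit.
Unset Printing Implicit Defensive.
Import Order.TTheory GRing.Theory Num.Theory.
Local Open Scope ring_scope.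

(** Write Gam for the surrogate matrix and Q(D) = <Gam D, D>.

    Restricted convexity and smoothness are conditions on Q with a nuclear-norm
    slack.  On a matrix with a single nonzero column the nuclear and Frobenius
    norms agree, and Q is the sum of its values on the columns of its argument,
    so both conditions turn into plain Frobenius bounds
      (alpha1 - tau) |D|^2 <= Q(D) <= (alpha2 + tau) |D|^2
    ([restricted_convexity_spectrum], [restricted_smoothness_spectrum]).

    Let g_t be the optimality gap Psi(Theta^t) - Psi(hat Theta) and
    b = alpha1 / (8 v) <= 1/32.  If 0 < kappa < 1, both denominators in kappa and
    xi are positive, hence kappa >= 1 - b, xi >= 5 tau and
    256 tau lambda^(-q) R_q <= b alpha1 ([kappa_bounds]).  The heart of the proof
    is the one-step recursion
      g_(t+1) <= max(delta, kappa g_t),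
    which gives g_t <= max(delta, kappa^t g_0) ([geometric_floor]); this is at
    most delta as soon as t exceeds the stated bound ([iter_bound_reached]).  The
    recursion starts from [prox_descent], where the next iterate is compared with
    a point on the segment from the current iterate to hat Theta, and splits into
    two regimes.

    If 2 tau <= alpha1, then Q is strongly convex and the proximal gradient
    method contracts without any noise floor
    ([strongly_convex_contraction], [strongly_convex_error]).

    If 2 tau > alpha1, the bound on tau lambda^(-q) R_q forces
    lambda^(-q) R_q < 1.  Then no singular value of Theta* exceeds lambda, so its
    nuclear norm is at most h = lambda^(1-q) R_q, and eps_stat >= 8 h
    ([schatten_ball_nuclear], [eps_stat_ge]).  On the ball of radius omega all
    nonconvexity is dominated by the regulariser because
    4 tau omega <= 4 rate <= lambda; so the gap controls lambda times the nuclear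
    distance to hat Theta, up to a multiple of lambda h ([nuclear_hat_le_gap]).
    While the gap is large compared with lambda h this yields contraction.  Once
    it is not, the current iterate and the next are within a multiple of h of
    hat Theta, the slack of the recursion is quadratic, of order tau h^2, and the
    floor 2560 tau h^2 / b, which is at most delta, absorbs it.  If tau is small
    compared with v this works directly ([moderate_contraction]); if tau is
    comparable to v or larger, the gradient step may overshoot, but lambda / v is
    then so large compared with omega that a single step lands within 26 h of
    Theta* ([overstep_target], [overstep_contraction]).

    Finally a gap of at most delta is converted into the Frobenius bound by
    [strongly_convex_error] or [floor_error]. *)

(** * The trace inner product *)

Section InnerProduct.
Context {R : realType} {m n : nat}.
Implicit Types A B C : 'M[R]_(m, n).

Lemma innerE A B : inner A B = \sum_i \sum_j A i j * B i j.
Proof.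
rewrite /inner /mxtrace exchange_big /=; apply: eq_bigr => j _.
by rewrite mxE; apply: eq_bigr => i _; rewrite mxE.
Qed.

Lemma innerC A B : inner A B = inner B A.
Proof. by rewrite /inner -mxtrace_tr trmx_mul trmxK. Qed.

Lemma innerDl A B C : inner (A + B) C = inner A C + inner B C.
Proof. by rewrite /inner linearD mulmxDl mxtraceD. Qed.

Lemma innerZl a A B : inner (a *: A) B = a * inner A B.
Proof. by rewrite /inner linearZ /= -scalemxAl mxtraceZ. Qed.

Lemma innerDr A B C : inner A (B + C) = inner A B + inner A C.
Proof. by rewrite innerC innerDl !(innerC A). Qed.

Lemma innerZr a A B : inner A (a *: B) = a * inner A B.
Proof. by rewrite innerC innerZl innerC. Qed.

Lemma innerNl A B : inner (- A) B = - inner A B.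
Proof. by rewrite -scaleN1r innerZl mulN1r. Qed.

Lemma innerNr A B : inner A (- B) = - inner A B.
Proof. by rewrite innerC innerNl innerC. Qed.

Lemma inner_ge0 A : 0 <= inner A A.
Proof. by rewrite innerE; do 2!apply: sumr_ge0 => ? _; rewrite -expr2 sqr_ge0. Qed.

Lemma inner_sym (G : 'M[R]_m) A B : G^T = G ->
  inner (G *m A) B = inner (G *m B) A.
Proof.
by move=> GT; rewrite [RHS]innerC /inner trmx_mul GT mulmxA.
Qed.

Definition inner_linear := (innerDl, innerDr, innerNl, innerNr, innerZl, innerZr).

Lemma inner_eq0 A : inner A A = 0 -> A = 0.
Proof.
rewrite innerE pair_big /= => /eqP.
rewrite psumr_eq0 => [/allP A0|ij _]; last by rewrite -expr2 sqr_ge0.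
apply/matrixP => i j; have := A0 (i, j) (mem_index_enum _).
by rewrite /= -expr2 sqrf_eq0 mxE => /eqP.
Qed.

(** Cauchy-Schwarz for the symmetric form v <A, B> - <Gam A, B>, which need not be
    positive: polarise at e A + d B and e A - d B, where |A| <= d and |B| <= e
    make the two quadratic terms balance. *)
Lemma bilinear_cauchy (G : 'M[R]_m) (v c d e : R) A B : G^T = G -> 0 <= c ->
    (forall C, `|v * inner C C - inner (G *m C) C| <= c * inner C C) ->
    0 <= d -> 0 <= e -> inner A A <= d ^+ 2 -> inner B B <= e ^+ 2 ->
  v * inner A B - inner (G *m A) B <= c * d * e.
Proof.
move=> GT c0 Mc d0 e0 Ad Be.
have [d_eq0|d_neq0] := eqVneq d 0.
  have -> : A = 0.
    by apply/inner_eq0/le_anti; rewrite inner_ge0 andbT (le_trans Ad) // d_eq0 expr0n.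
  by rewrite mulmx0 -(scale0r 0) !innerZl !mul0r mulr0 subr0 !mulr_ge0.
have [e_eq0|e_neq0] := eqVneq e 0.
  have -> : B = 0.
    by apply/inner_eq0/le_anti; rewrite inner_ge0 andbT (le_trans Be) // e_eq0 expr0n.
  by rewrite -(scale0r 0) !innerZr !mul0r mulr0 subr0 !mulr_ge0.
have de : 0 < 4 * (d * e) by rewrite !mulr_gt0 // lt_def ?d_neq0 ?e_neq0.
have := Mc (e *: A + d *: B); have := Mc (e *: A - d *: B).
rewrite !mulmxDr mulmxN -!scalemxAr !inner_linear (innerC B A).
rewrite (inner_sym B A GT) !ler_norml => /andP[h1 _] /andP[_ h2].
rewrite -(ler_pM2l de).
have := ler_wpM2l c0 (ler_wpM2l (sqr_ge0 e) Ad).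
have := ler_wpM2l c0 (ler_wpM2l (sqr_ge0 d) Be).
lra.
Qed.

Lemma frob_norm_sqr A : frob_norm A ^+ 2 = inner A A.
Proof. by rewrite sqr_sqrtr // inner_ge0. Qed.

(** The difference of the two sides is half the square of A + 3 B. *)
Lemma inner_young A B :
  inner A A <= 3 / 2 * inner (A + B) (A + B) + 3 * inner B B.
Proof.
by have := inner_ge0 (A + 3 *: B); rewrite !inner_linear (innerC B A); lra.
Qed.

End InnerProduct.

(** * Duality and convexity of the nuclear norm *)

Section NuclearNorm.
Context {R : realType} {m n : nat}.
Implicit Types A B : 'M[R]_(m, n).

(** The operator norm of B is at most c.  The polarised form of |x^T B y| <= c |x| |y|
    avoids square roots and unit vectors, and survives sums term by term. *)
Definition op_bounded (c : R) B : Prop :=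
  forall (x : 'cV[R]_m) (y : 'cV[R]_n),
    2 * (x^T *m B *m y) 0 0 <= c * (inner x x + inner y y).

Lemma bessel k d (U : 'M[R]_(d, k)) (x : 'cV[R]_d) : U^T *m U = 1%:M ->
  inner (U^T *m x) (U^T *m x) <= inner x x.
Proof.
move=> UU; have := inner_ge0 (x - U *m (U^T *m x)).
have Ux : inner x (U *m (U^T *m x)) = inner (U^T *m x) (U^T *m x).
  by rewrite /inner trmx_mul trmxK !mulmxA.
have UUx : inner (U *m (U^T *m x)) (U *m (U^T *m x))
         = inner (U^T *m x) (U^T *m x).
  by rewrite [in LHS]/inner trmx_mul -mulmxA (mulmxA U^T U) UU mul1mx.
rewrite !inner_linear (innerC _ x) Ux UUx; lra.
Qed.

(** In the singular coordinates a = U^T x and b = V^T y the form is a weighted sum of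
    the products a_j b_j, to which the arithmetic-geometric inequality applies;
    Bessel's inequality returns to x and y. *)
Lemma op_bounded_svd k (U : 'M[R]_(m, k)) (V : 'M[R]_(n, k)) (s : 'rV[R]_k) c :
    U^T *m U = 1%:M -> V^T *m V = 1%:M -> (forall j, 0 <= s 0 j <= c) ->
    0 <= c ->
  op_bounded c (U *m diag_mx s *m V^T).
Proof.
move=> UU VV sc c0 x y.
set a := U^T *m x; set b := V^T *m y.
have -> : x^T *m (U *m diag_mx s *m V^T) *m y = a^T *m diag_mx s *m b.
  by rewrite /a /b trmx_mul trmxK !mulmxA.
apply: (@le_trans _ _ (c * (inner a a + inner b b))); last first.
  by apply: ler_wpM2l => //; apply: lerD; exact: bessel.
clearbody a b.
rewrite !innerE -big_split mxE !mulr_sumr /=; apply: ler_sum => j _.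
rewrite !big_ord1 mul_mx_diag !mxE; have /andP[s0 sc'] := sc j.
move: (a j 0) (b j 0) => p r.
have h1 : 0 <= s 0 j * (p - r) ^+ 2 by rewrite mulr_ge0 // sqr_ge0.
have h2 : 0 <= (c - s 0 j) * (p ^+ 2 + r ^+ 2).
  by rewrite mulr_ge0 ?subr_ge0 // addr_ge0 // sqr_ge0.
lra.
Qed.

Lemma sing_vals_bounds A j : (j < minn m n)%N ->
  0 <= (sing_vals A)`_j <= (sing_vals A)`_0.
Proof.
move=> jk; have [sz srt /allP pos _] := sing_valsP A.
rewrite pos ?mem_nth ?sz //=.
apply: (sorted_leq_nth _ _ 0 srt) => //; rewrite ?inE ?sz //.
- by move=> a b c ba cb; exact: le_trans cb ba.
- by move=> a; exact: lexx.
- exact: leq_ltn_trans (leq0n j) jk.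
Qed.

Lemma op_norm_bounded A : op_bounded (op_norm A) A.
Proof.
have [sz srt /allP pos [U [V [UU VV AE]]]] := sing_valsP A.
rewrite [X in op_bounded _ X]AE; apply: op_bounded_svd => //.
- by move=> j; rewrite mxE; exact: sing_vals_bounds.
rewrite /op_norm; case: (posnP (minn m n)) => [k0|kp].
  by rewrite nth_default // sz k0.
by case/andP: (sing_vals_bounds A kp).
Qed.

Lemma inner_sing_vals A : exists (U : 'M[R]_(m, minn m n)) (V : 'M[R]_(n, minn m n)),
  [/\ U^T *m U = 1%:M, V^T *m V = 1%:M &
  forall B, inner B A =
    \sum_(j < minn m n) (sing_vals A)`_j * ((col j U)^T *m B *m col j V) 0 0].
Proof.
have [sz srt pos [U [V [UU VV AE]]]] := sing_valsP A.
exists U, V; split=> // B.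
rewrite [in LHS]AE innerC /inner trmx_mul trmxK -mulmxA mxtrace_mulC.
rewrite trmx_mul tr_diag_mx -2!mulmxA mul_diag_mx mulmxA /mxtrace.
apply: eq_bigr => j _; rewrite !mxE; congr (_ * _).
apply: eq_bigr => l _; rewrite !mxE; congr (_ * _).
by apply: eq_bigr => i _; rewrite !mxE.
Qed.

Lemma inner_col_orth k d (U : 'M[R]_(d, k)) j : U^T *m U = 1%:M ->
  inner (col j U) (col j U) = 1.
Proof.
move=> /matrixP/(_ j j); rewrite !mxE eqxx mulr1n => <-.
by rewrite innerE; apply: eq_bigr => i _; rewrite big_ord1 !mxE.
Qed.

(** Easy half of the duality between operator and nuclear norm: B is tested against the
    pairs of singular vectors of A. *)
Lemma inner_le_nuclear c B A : op_bounded c B -> inner B A <= c * nuclear_norm A.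
Proof.
move=> hB; have [U [V [UU VV ->]]] := inner_sing_vals A.
rewrite mulr_sumr; apply: ler_sum => j _.
have /andP[s0 _] := sing_vals_bounds A (ltn_ord j).
have := hB (col j U) (col j V); rewrite !inner_col_orth // => h.
by rewrite mulrC ler_wpM2r //; lra.
Qed.

(** The supremum in the duality is attained at U V^T; this is what makes the nuclear
    norm convex. *)
Lemma nuclear_dual A : exists2 Z, op_bounded 1 Z & nuclear_norm A = inner Z A.
Proof.
have [sz srt pos [U [V [UU VV AE]]]] := sing_valsP A.
exists (U *m V^T).
  rewrite -[U]mulmx1 -diag_const_mx; apply: op_bounded_svd => // j.
  by rewrite mxE ler01 lexx.
rewrite innerC [in RHS]AE /inner trmx_mul trmxK trmx_mul tr_diag_mx.
rewrite -!mulmxA (mulmxA U^T) UU mul1mx mxtrace_mulC -mulmxA VV mulmx1.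
by rewrite mxtrace_diag; apply: eq_bigr => j _; rewrite mxE.
Qed.

Lemma nuclear_norm_ge0 A : 0 <= nuclear_norm A.
Proof.
by apply: sumr_ge0 => j _; case/andP: (sing_vals_bounds A (ltn_ord j)).
Qed.

Lemma nuclear_norm_convex a b A B : 0 <= a -> 0 <= b ->
  nuclear_norm (a *: A + b *: B) <= a * nuclear_norm A + b * nuclear_norm B.
Proof.
move=> a0 b0; have [Z hZ ->] := nuclear_dual (a *: A + b *: B).
rewrite !inner_linear; apply: lerD; apply: ler_wpM2l => //.
  by rewrite -[leRHS]mul1r inner_le_nuclear.
by rewrite -[leRHS]mul1r inner_le_nuclear.
Qed.

Lemma nuclear_normN A : nuclear_norm (- A) <= nuclear_norm A.
Proof.
have [Z hZ ->] := nuclear_dual (- A).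
rewrite innerNr -innerNl -[leRHS]mul1r; apply: inner_le_nuclear => x y.
have := hZ (- x) y; rewrite !inner_linear opprK.
by rewrite linearN /= mulNmx mulmxN.
Qed.

Lemma nuclear_normD A B : nuclear_norm (A + B) <= nuclear_norm A + nuclear_norm B.
Proof.
by have := @nuclear_norm_convex 1 1 A B ler01 ler01; rewrite !scale1r !mul1r.
Qed.

Lemma nuclear_normB A B : nuclear_norm (A - B) <= nuclear_norm A + nuclear_norm B.
Proof. by apply: le_trans (nuclear_normD _ _) _; rewrite lerD2l nuclear_normN. Qed.

Lemma inner_le_nuclear_sqr A : inner A A <= nuclear_norm A ^+ 2.
Proof.
have op_nuc : op_norm A <= nuclear_norm A.
  rewrite /op_norm; have [sz _ _ _] := sing_valsP A.
  case: (posnP (minn m n)) => [k0|kp].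
    by rewrite nth_default ?sz ?k0 // -/(nuclear_norm A) nuclear_norm_ge0.
  rewrite /nuclear_norm (bigD1 (Ordinal kp)) //= lerDl sumr_ge0 // => j _.
  by case/andP: (sing_vals_bounds A (ltn_ord j)).
apply: le_trans (inner_le_nuclear _ (op_norm_bounded A)) _.
by rewrite expr2 ler_wpM2r // nuclear_norm_ge0.
Qed.

(** With Z the dual certificate, t x^T Z y is bounded by the quadratic
    (t^2 |x|^2 + |y|^2) / 2 for every t; the optimal t is x^T Z y / |x|^2. *)
Lemma nuclear_norm_rank1 (x : 'cV[R]_m) (y : 'cV[R]_n) :
  nuclear_norm (x *m y^T) ^+ 2 <= inner x x * inner y y.
Proof.
have [Z hZ ->] := nuclear_dual (x *m y^T).
have -> : inner Z (x *m y^T) = (x^T *m Z *m y) 0 0.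
  rewrite innerC /inner trmx_mul trmxK -[y *m _ *m _]mulmxA mxtrace_mulC.
  by rewrite /mxtrace big_ord1.
set z : R := fun_of_matrix _ 0 0.
have bound t : 2 * t * z <= t ^+ 2 * inner x x + inner y y.
  have := hZ (t *: x) y; rewrite !inner_linear linearZ /= -!scalemxAl mxE -/z.
  lra.
have [x0|x0] := eqVneq (inner x x) 0.
  have z0 : z = 0.
    apply/eqP/negP => /negP z0; have := bound ((inner y y + 1) / z).
    by rewrite x0 -mulrA divfK //; have := inner_ge0 y; lra.
  by rewrite z0 x0 expr0n mul0r.
have := bound (z / inner x x).
have xp : 0 < inner x x by rewrite lt_def x0 inner_ge0.
rewrite -(ler_pM2r xp) => h.
have e1 : 2 * (z / inner x x) * z * inner x x = 2 * z ^+ 2 by field.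
have e2 : ((z / inner x x) ^+ 2 * inner x x + inner y y) * inner x x
   = z ^+ 2 + inner x x * inner y y by field.
move: h; rewrite e1 e2; lra.
Qed.

End NuclearNorm.

(** * From restricted conditions to Frobenius bounds *)

Section Spectrum.
Context {R : realType} {m n : nat}.
Implicit Types (G : 'M[R]_m) (D : 'M[R]_(m, n)).

Lemma inner_col_decomposition G D :
  inner (G *m D) D = \sum_j inner (G *m col j D) (col j D).
Proof.
rewrite innerE exchange_big /=; apply: eq_bigr => j _.
rewrite innerE; apply: eq_bigr => i _; rewrite big_ord1 !mxE; congr (_ * _).
by apply: eq_bigr => l _; rewrite !mxE.
Qed.

Lemma inner_col_lift G (x : 'cV[R]_m) (j : 'I_n) :
  inner (G *m (x *m (delta_mx j 0)^T)) (x *m (delta_mx j 0)^T)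
  = inner (G *m x) x.
Proof.
rewrite mulmxA {1}/inner trmx_mul trmxK -mulmxA mxtrace_mulC -mulmxA -mulmxA.
rewrite trmx_delta mul_delta_mx; congr (\tr (_ *m _)).
by rewrite [delta_mx _ _]mx11_scalar mxE !eqxx mulmx1.
Qed.

Lemma nuclear_norm_col_lift (x : 'cV[R]_m) (j : 'I_n) :
  nuclear_norm (x *m (delta_mx j 0)^T) ^+ 2 <= inner x x.
Proof.
apply: le_trans (nuclear_norm_rank1 _ _) _.
rewrite [inner (delta_mx j 0) _]/inner trmx_delta mul_delta_mx /mxtrace.
by rewrite big_ord1 mxE !eqxx mulr1.
Qed.

Lemma inner_sum_cols D : inner D D = \sum_j inner (col j D) (col j D).
Proof.
have := inner_col_decomposition 1%:M D; rewrite mul1mx => ->.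
by apply: eq_bigr => j _; rewrite mul1mx.
Qed.

Lemma inner_lift (x : 'cV[R]_m) (j : 'I_n) :
  inner (x *m (delta_mx j 0)^T) (x *m (delta_mx j 0)^T) = inner x x.
Proof. by have := inner_col_lift 1%:M x j; rewrite !mul1mx. Qed.

(** The nuclear slack of a one-column matrix is its Frobenius norm, so testing on
    single columns and summing over them loses nothing. *)
Lemma restricted_convexity_spectrum G alpha tau D : 0 <= tau ->
  restricted_strong_convexity n G alpha tau ->
  (alpha - tau) * inner D D <= inner (G *m D) D.
Proof.
move=> t0 rsc; rewrite inner_col_decomposition inner_sum_cols mulr_sumr.
apply: ler_sum => j _; set x := col j D.
have := rsc (x *m (delta_mx j 0)^T); rewrite inner_col_lift frob_norm_sqr inner_lift.
have := ler_wpM2l t0 (nuclear_norm_col_lift x j); lra.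
Qed.

Lemma restricted_smoothness_spectrum G alpha tau D : 0 <= tau ->
  restricted_strong_smoothness n G alpha tau ->
  inner (G *m D) D <= (alpha + tau) * inner D D.
Proof.
move=> t0 rss; rewrite inner_col_decomposition inner_sum_cols mulr_sumr.
apply: ler_sum => j _; set x := col j D.
have := rss (x *m (delta_mx j 0)^T); rewrite inner_col_lift frob_norm_sqr inner_lift.
have := ler_wpM2l t0 (nuclear_norm_col_lift x j); lra.
Qed.

End Spectrum.

(** * First-order conditions on the nuclear ball *)

Section CompositeMinimisation.
Context {R : realType} {m n : nat}.
Implicit Types (A B H X : 'M[R]_(m, n)).

(** The linear term dominates as t tends to 0. *)
Lemma linear_term_ge0 (p c : R) :
  (forall t, 0 < t -> t <= 1 -> 0 <= t * p + t ^+ 2 * c) -> 0 <= p.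
Proof.
move=> h; rewrite leNgt; apply/negP => p0.
have d0 : 0 < `|c| - p by have := normr_ge0 c; lra.
(* small enough for t c < - p, and at most 1 *)
pose t := - p / (`|c| - p).
have td : t * (`|c| - p) = - p by rewrite divfK // gt_eqF.
have t0 : 0 < t by rewrite divr_gt0 // oppr_gt0.
have t1 : t <= 1 by rewrite ler_pdivrMr // mul1r; have := normr_ge0 c; lra.
have := h t t0 t1; rewrite expr2 -mulrA -mulrDr pmulr_rge0 //.
have := ler_wpM2l (ltW t0) (ler_norm c).
have : t * p < 0 by rewrite pmulr_rlt0.
lra.
Qed.

Lemma segmentE A B t : A + t *: (B - A) = (1 - t) *: A + t *: B.
Proof. by rewrite scalerBr scalerBl scale1r addrAC addrA. Qed.

Lemma nuclear_norm_segment A B t : 0 <= t -> t <= 1 ->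
  nuclear_norm (A + t *: (B - A))
    <= (1 - t) * nuclear_norm A + t * nuclear_norm B.
Proof.
by move=> t0 t1; rewrite segmentE nuclear_norm_convex // subr_ge0.
Qed.

Lemma nuclear_ball_segment omega A B t : 0 <= t -> t <= 1 ->
  nuclear_ball omega A -> nuclear_ball omega B ->
  nuclear_ball omega (A + t *: (B - A)).
Proof.
rewrite /nuclear_ball => t0 t1 hA hB.
apply: le_trans (nuclear_norm_segment A B t0 t1) _.
have t1' : 0 <= 1 - t by lra.
have := lerD (ler_wpM2l t1' hA) (ler_wpM2l t0 hB); lra.
Qed.

(** Variational inequality at a minimiser of a smooth function plus a multiple of the
    nuclear norm.  The remainder r is any function homogeneous of degree two: it
    disappears when moving an infinitesimal amount towards B. *)
Lemma argmin_first_order omega mu (f r : 'M[R]_(m, n) -> R) X G :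
    0 <= mu ->
    (forall H, f (X + H) = f X + inner G H + r H) ->
    (forall t H, r (t *: H) = t ^+ 2 * r H) ->
    is_argmin (nuclear_ball omega) (fun A => f A + mu * nuclear_norm A) X ->
  forall B, nuclear_ball omega B ->
    0 <= inner G (B - X) + mu * (nuclear_norm B - nuclear_norm X).
Proof.
move=> mu0 fE rE [SX opt] B SB; apply: (@linear_term_ge0 _ (r (B - X))).
move=> t t0 t1; have := opt _ (nuclear_ball_segment (ltW t0) t1 SX SB).
rewrite fE rE innerZr.
have := ler_wpM2l mu0 (nuclear_norm_segment X B (ltW t0) t1); lra.
Qed.

End CompositeMinimisation.

(** * One proximal gradient step *)

Section ProximalStep.
Context {R : realType} {m n : nat} (G : 'M[R]_m) (Ups : 'M[R]_(m, n)).
Context (lam omega v : R).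
Context (G_sym : G^T = G) (lam_gt0 : 0 < lam) (v_gt0 : 0 < v).
Implicit Types A B D T X : 'M[R]_(m, n).

Local Notation S := (nuclear_ball omega).
Local Notation Psi := (objective G Ups lam).
Local Notation Q D := (inner (G *m D) D).
Local Notation nuc := nuclear_norm.

(** The linear part of the expansion of Psi at its minimiser is nonnegative. *)
Lemma objective_growth That T : is_argmin S Psi That -> S T ->
  2^-1 * Q (T - That) <= Psi T - Psi That.
Proof.
move=> opt ST.
have := @argmin_first_order _ _ _ omega lam (loss G Ups)
  (fun H => 2^-1 * Q H) That _ (ltW lam_gt0)
  (fun H => loss_expansion Ups That H G_sym) _ opt T ST.
have rE (t : R) (H : 'M[R]_(m, n)) : 2^-1 * Q (t *: H) = t ^+ 2 * (2^-1 * Q H).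
  by rewrite -scalemxAr !inner_linear; ring.
move=> /(_ rE); rewrite /objective.
have := loss_expansion Ups That (T - That) G_sym; rewrite addrC subrK => ->.
lra.
Qed.

(** Multiplying the first-order condition of the proximal problem by v turns its
    gradient X - (T - grad / v) into grad + v (X - T). *)
Lemma prox_first_order T X : is_argmin S (prox_objective G Ups lam v T) X ->
  forall B, S B ->
  0 <= inner (grad_loss G Ups T) (B - X) + v * inner (X - T) (B - X)
       + lam * (nuc B - nuc X).
Proof.
move=> opt B SB; set C := T - v^-1 *: grad_loss G Ups T.
have fE H : 2^-1 * frob_norm (X + H - C) ^+ 2
    = 2^-1 * frob_norm (X - C) ^+ 2 + inner (X - C) H + 2^-1 * inner H H.
  rewrite !frob_norm_sqr (_ : X + H - C = X - C + H); last by rewrite addrAC.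
  by move: (X - C) => A; rewrite !inner_linear (innerC H A); field.
have rE (t : R) (H : 'M[R]_(m, n)) : 2^-1 * inner (t *: H) (t *: H)
    = t ^+ 2 * (2^-1 * inner H H) by rewrite !inner_linear; ring.
have mu0 : 0 <= lam / v by rewrite divr_ge0 // ltW.
have := argmin_first_order mu0 fE rE opt SB.
rewrite -(pmulr_rge0 _ v_gt0); congr (_ <= _).
by rewrite /C; move: (B - X) => H; rewrite !inner_linear; field; rewrite gt_eqF.
Qed.

(** Test the optimality of X against T + a (That - T).  With g the gradient at T,
    exact quadratic expansions at T give the terms <g, X - T> and <g, T - That>, and
    both cancel against the variational inequality; the cross term a v <X - T, T - That>
    is completed to a square. *)
Lemma prox_descent That T X (a : R) : is_argmin S Psi That -> S T ->
    is_argmin S (prox_objective G Ups lam v T) X -> 0 <= a -> a <= 1 ->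
  Psi X - Psi That <= (1 - a) * (Psi T - Psi That) - a / 2 * Q (T - That)
    + 2^-1 * (Q (X - T) - v * inner (X - T) (X - T))
    + v * a ^+ 2 / 2 * inner (T - That) (T - That)
    - v / 2 * inner (X - T + a *: (T - That)) (X - T + a *: (T - That)).
Proof.
move=> [Shat _] ST opt a0 a1.
set D : 'M[R]_(m, n) := T - That; set E : 'M[R]_(m, n) := X - T.
have vi := prox_first_order opt (nuclear_ball_segment a0 a1 ST Shat).
have cvx := ler_wpM2l (ltW lam_gt0) (nuclear_norm_segment T That a0 a1).
have lX : Psi X = loss G Ups T + inner (grad_loss G Ups T) E + 2^-1 * Q E
    + lam * nuc X.
  have XE : X = T + E by rewrite /E addrC subrK.
  by rewrite /objective {1}XE loss_expansion.
have lH : Psi That = loss G Ups T - inner (grad_loss G Ups T) D + 2^-1 * Q D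
    + lam * nuc That.
  have HE : That = T - D by rewrite /D opprB addrC subrK.
  by rewrite /objective {1}HE loss_expansion // mulmxN !(innerNr, innerNl) opprK.
have dir : T + a *: (That - T) - X = - (E + a *: D).
  by rewrite /E /D; apply/matrixP => i j; rewrite !mxE; ring.
move: vi; rewrite lX lH dir -/E; clearbody D E.
rewrite /objective !inner_linear (innerC D E).
move: cvx; lra.
Qed.

End ProximalStep.

(** * Contraction of the optimality gap *)

Section Contraction.
Context {R : realType} {m n : nat} (G : 'M[R]_m) (Ups : 'M[R]_(m, n)).
Context (lam omega v alpha tau b : R).
Context (G_sym : G^T = G) (lam_gt0 : 0 < lam) (v_gt0 : 0 < v).
Context (tau_gt0 : 0 < tau) (b_gt0 : 0 < b) (b_le : b <= 32^-1).
Context (alphaE : alpha = 8 * b * v).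
Implicit Types A B D T X : 'M[R]_(m, n).

Local Notation S := (nuclear_ball omega).
Local Notation Psi := (objective G Ups lam).
Local Notation Q D := (inner (G *m D) D).
Local Notation nuc := nuclear_norm.

Context (Q_ge : forall D, (alpha - tau) * inner D D <= Q D).
Context (Q_le : forall D, Q D <= (v + tau) * inner D D).
Context (That : 'M[R]_(m, n)) (That_opt : is_argmin S Psi That).

Lemma gap_ge0 T : S T -> 0 <= Psi T - Psi That.
Proof. by case: That_opt => _ opt /opt; rewrite subr_ge0. Qed.

(** With tau possibly as large as v, the distance between consecutive iterates has to
    be kept; it is controlled separately in [overstep_target]. *)
Lemma coarse_descent T X (a : R) : S T ->
    is_argmin S (prox_objective G Ups lam v T) X -> 0 <= a -> a <= 1 ->
  Psi X - Psi That <= (1 - a) * (Psi T - Psi That)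
    + a / 2 * (a * v - alpha + tau) * inner (T - That) (T - That)
    + tau / 2 * inner (X - T) (X - T).
Proof.
move=> ST opt a0 a1.
have := prox_descent G_sym lam_gt0 v_gt0 That_opt ST opt a0 a1.
have := ler_wpM2l a0 (Q_ge (T - That)); have := Q_le (X - T).
have := mulr_ge0 (ltW v_gt0) (inner_ge0 (X - T + a *: (T - That))).
lra.
Qed.

(** When tau <= 2 v / 3, the square left over in [prox_descent] absorbs the
    distance between consecutive iterates, by [inner_young]. *)
Lemma fine_descent T X (a : R) : 3 * tau <= 2 * v -> S T ->
    is_argmin S (prox_objective G Ups lam v T) X -> 0 <= a -> a <= 1 ->
  Psi X - Psi That <= (1 - a) * (Psi T - Psi That)
    + a / 2 * (3 * a * v - alpha + tau) * inner (T - That) (T - That).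
Proof.
move=> tv ST opt a0 a1.
have := prox_descent G_sym lam_gt0 v_gt0 That_opt ST opt a0 a1.
have := ler_wpM2l a0 (Q_ge (T - That)); have := Q_le (X - T).
have := ler_wpM2l (ltW tau_gt0) (inner_young (X - T) (a *: (T - That))).
move: (T - That) (X - T) => D E; rewrite [inner (a *: D) (a *: D)]innerZl innerZr.
have tv' : 0 <= 2 * v - 3 * tau by lra.
have := mulr_ge0 tv' (inner_ge0 (E + a *: D)).
have := mulr_ge0 tv' (mulr_ge0 (sqr_ge0 a) (inner_ge0 D)).
lra.
Qed.

(** The step a = 4 b / 3 = alpha / (6 v) makes the quadratic coefficient in
    [fine_descent] equal to (tau - alpha / 2) a / 2, which is not positive. *)
Lemma strongly_convex_contraction T X : 2 * tau <= alpha -> S T ->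
    is_argmin S (prox_objective G Ups lam v T) X ->
  Psi X - Psi That <= (1 - b) * (Psi T - Psi That).
Proof.
move=> ta ST opt.
have bv : b * v <= 32^-1 * v by rewrite ler_wpM2r // ltW.
have tv : 3 * tau <= 2 * v by have := v_gt0; move: ta; rewrite alphaE; lra.
have a0 : 0 <= 4 / 3 * b by have := b_gt0; lra.
have a1 : 4 / 3 * b <= 1 by have := b_le; lra.
have := fine_descent tv ST opt a0 a1.
have := mulr_ge0 (ltW b_gt0) (gap_ge0 ST).
have c0 : 0 <= alpha - 2 * tau by lra.
have := mulr_ge0 (ltW b_gt0) (mulr_ge0 c0 (inner_ge0 (T - That))).
rewrite alphaE; lra.
Qed.

Lemma strongly_convex_error T : 2 * tau <= alpha -> S T ->
  alpha / 4 * inner (T - That) (T - That) <= Psi T - Psi That.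
Proof.
move=> ta ST; have := objective_growth G_sym lam_gt0 That_opt ST.
have := Q_ge (T - That).
have c0 : 0 <= alpha - 2 * tau by lra.
have := mulr_ge0 c0 (inner_ge0 (T - That)); lra.
Qed.

(** ** A nearly vanishing target *)

Section SmallTarget.
Context (Tstar : 'M[R]_(m, n)) (rate h : R).
Context (Tstar_in : S Tstar) (Tstar_small : nuc Tstar <= h).
Context (noise : op_bounded rate (Ups - G *m Tstar)).
Context (tau_rate : tau * omega <= rate) (rate_lam : 4 * rate <= lam).

Let h_ge0 : 0 <= h := le_trans (nuclear_norm_ge0 _) Tstar_small.
Let alpha_gt0 : 0 < alpha. Proof. by rewrite alphaE !mulr_gt0. Qed.

Lemma nuclear_ball_diam A B : S A -> S B -> nuc (A - B) <= 2 * omega.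
Proof. by rewrite /nuclear_ball => hA hB; apply: le_trans (nuclear_normB A B) _; lra. Qed.

(** The regulariser dominates the nonconvexity: the squared Frobenius norm is at most
    nuclear norm times diameter, and tau (2 omega) <= 2 rate <= lam / 2. *)
Lemma tau_inner_le A B : S A -> S B ->
  tau * inner (A - B) (A - B) <= lam / 2 * nuc (A - B).
Proof.
move=> SA SB; have N0 := nuclear_norm_ge0 (A - B).
have h1 := ler_wpM2l (ltW tau_gt0) (inner_le_nuclear_sqr (A - B)).
have h2 := ler_wpM2r N0 (nuclear_ball_diam SA SB).
have h3 := ler_wpM2l (ltW tau_gt0) h2.
have h4 := ler_wpM2r N0 tau_rate; have h5 := ler_wpM2r N0 rate_lam.
lra.
Qed.

Lemma noise_le A : inner (Ups - G *m Tstar) A <= lam / 4 * nuc A.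
Proof.
apply: le_trans (inner_le_nuclear A noise) _.
by apply: ler_wpM2r; [exact: nuclear_norm_ge0 | have := rate_lam; lra].
Qed.

Lemma objective_starE T : Psi T - Psi Tstar =
  2^-1 * Q (T - Tstar) - inner (Ups - G *m Tstar) (T - Tstar)
  + lam * (nuc T - nuc Tstar).
Proof.
rewrite /objective; have := loss_expansion Ups Tstar (T - Tstar) G_sym.
rewrite [Tstar + _]addrC subrK => ->.
by rewrite /grad_loss -(opprB Ups) innerNl; ring.
Qed.

(** Noise and nonconvexity each cost a quarter of lam nuc (T - Tstar), and the
    regulariser pays for all of it except 2 lam h. *)
Lemma objective_star_ge T : S T ->
  lam / 2 * nuc (T - Tstar) - 2 * (lam * h) <= Psi T - Psi Tstar.
Proof.
move=> ST; rewrite objective_starE.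
have h1 := Q_ge (T - Tstar); have h2 := noise_le (T - Tstar).
have h3 := tau_inner_le ST Tstar_in.
have h4 := mulr_ge0 (ltW alpha_gt0) (inner_ge0 (T - Tstar)).
have h5 := ler_wpM2l (ltW lam_gt0) (nuclear_normB T Tstar).
have h6 := ler_wpM2l (ltW lam_gt0) Tstar_small.
lra.
Qed.

Lemma nuclear_star_le_gap T : S T ->
  lam * nuc (T - Tstar) <= 2 * (Psi T - Psi That) + 4 * (lam * h).
Proof.
move=> ST; have := objective_star_ge ST.
by have := That_opt.2 _ Tstar_in; lra.
Qed.

(** Analogue of the usual cone inequality, without a rank term because the target has
    no significant singular value. *)
Lemma nuclear_hat_le_gap T : S T ->
  lam * nuc (T - That) <= 2 * (Psi T - Psi That) + 8 * (lam * h).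
Proof.
move=> ST; have h1 := nuclear_star_le_gap ST.
have h2 := nuclear_star_le_gap That_opt.1.
have -> : T - That = (T - Tstar) - (That - Tstar) by rewrite opprB addrA subrK.
have := ler_wpM2l (ltW lam_gt0) (nuclear_normB (T - Tstar) (That - Tstar)); lra.
Qed.

Lemma objective_star_le : Psi Tstar - Psi That <= 2 * (lam * h).
Proof.
have := objective_star_ge That_opt.1.
have := mulr_ge0 (ltW lam_gt0) (nuclear_norm_ge0 (That - Tstar)); lra.
Qed.

(** The nonconvexity is paid in nuclear norm here, to be bounded by the gap later. *)
Lemma floor_error T : S T ->
  alpha / 2 * inner (T - That) (T - That) <= (Psi T - Psi That)
    + tau / 2 * nuc (T - That) ^+ 2.
Proof.
move=> ST; have := objective_growth G_sym lam_gt0 That_opt ST.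
have := Q_ge (T - That).
have := ler_wpM2l (ltW tau_gt0) (inner_le_nuclear_sqr (T - That)); lra.
Qed.

(** The threshold e / (c - b) is where (c - b) g starts to exceed e. *)
Lemma affine_recursion (g g' c e : R) : b < c -> c <= 1 -> 0 <= e ->
  g' <= (1 - c) * g + e -> g' <= Num.max (e / (c - b)) ((1 - b) * g).
Proof.
move=> bc c1 e0 step; have cb : 0 < c - b by lra.
have f0 : 0 <= e / (c - b) by rewrite divr_ge0 // ltW.
have eE : e = (c - b) * (e / (c - b)) by field; rewrite gt_eqF.
move: step f0; rewrite {1}eE; move: (e / (c - b)) => f step f0.
have bf := mulr_ge0 (ltW b_gt0) f0.
have c1' : 0 <= 1 - c by lra.
rewrite le_max; have [small|big] := leP g f; apply/orP; [left|right].
  have := ler_wpM2l c1' small; lra.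
have := ler_wpM2l (ltW cb) (ltW big); lra.
Qed.

Local Notation floor := (2560 * tau * h ^+ 2 / b).

(** The step a = 8 b / 3 = alpha / (3 v) cancels alpha in [fine_descent], leaving
    (4 b / 3) tau |T - That|^2.  For gaps above 16 lam h this is at most
    (5 b / 3) times the gap, since it is linear in the nuclear distance by
    [tau_inner_le]; below, the distance is at most 40 h and it is of order tau h^2. *)
Lemma moderate_contraction T X : 3 * tau <= 2 * v -> S T ->
    is_argmin S (prox_objective G Ups lam v T) X ->
  Psi X - Psi That <= Num.max floor ((1 - b) * (Psi T - Psi That)).
Proof.
move=> tv ST opt.
have a0 : 0 <= 8 / 3 * b by have := b_gt0; lra.
have a1 : 8 / 3 * b <= 1 by have := b_le; lra.
have := fine_descent tv ST opt a0 a1.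
have g0 := gap_ge0 ST; have hN := nuclear_hat_le_gap ST.
have hI := tau_inner_le ST That_opt.1.
have hS := ler_wpM2l (ltW tau_gt0) (inner_le_nuclear_sqr (T - That)).
move: (Psi T - Psi That) (Psi X - Psi That) g0 hN hI hS => g g' g0 hN hI hS.
move: (inner _ _) (nuc (T - That)) (nuclear_norm_ge0 (T - That)) hN hI hS.
move=> I N N0 hN hI hS.
have -> : 8 / 3 * b / 2 * (3 * (8 / 3 * b) * v - alpha + tau) * I
   = 4 / 3 * b * (tau * I) by rewrite alphaE; field.
move=> step.
have [far|near] := leP (16 * (lam * h)) g.
  rewrite le_max; apply/orP; right.
  have hI' : tau * I <= 5 / 4 * g by lra.
  have := ler_wpM2l (ltW b_gt0) hI'.
  have := mulr_ge0 (ltW b_gt0) g0; lra.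
have Nh : N <= 40 * h by rewrite -(ler_pM2l lam_gt0); lra.
have N2 : N ^+ 2 <= 1600 * h ^+ 2.
  by have := ler_pM N0 N0 Nh Nh; rewrite -!expr2 exprMn; lra.
have hI' : tau * I <= 1600 * (tau * h ^+ 2).
  by apply: le_trans hS _; have := ler_wpM2l (ltW tau_gt0) N2; lra.
have c_gt : b < 8 / 3 * b by have := b_gt0; lra.
have th0 : 0 <= tau * h ^+ 2 by rewrite mulr_ge0 ?sqr_ge0 // ltW.
have c0 : 0 <= 4 / 3 * b by have := b_gt0; lra.
have e0 : 0 <= 4 / 3 * b * (1600 * (tau * h ^+ 2)).
  by apply: mulr_ge0 c0 _; lra.
have step' : g' <= (1 - 8 / 3 * b) * g + 4 / 3 * b * (1600 * (tau * h ^+ 2)).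
  by apply: le_trans step _; rewrite lerD2l ler_wpM2l.
apply: le_trans (affine_recursion c_gt a1 e0 step') _.
rewrite ge_max !le_max lexx orbT andbT; apply/orP; left.
have -> : 4 / 3 * b * (1600 * (tau * h ^+ 2)) / (8 / 3 * b - b)
   = 1280 * (tau * h ^+ 2).
  by field; rewrite gt_eqF //; have := b_gt0; lra.
rewrite ler_pdivlMr //; have := ler_wpM2l th0 b_le; lra.
Qed.

(** Since v + tau <= 5 tau / 2, Cauchy-Schwarz bounds the left side by 5/2 times
    tau (omega + nuc Tstar) nuc (X - Tstar), and tau omega <= lam / 4. *)
Lemma overstep_cross T X : 2 * v <= 3 * tau -> S T -> S X ->
  v * inner (T - Tstar) (X - Tstar) - inner (G *m (T - Tstar)) (X - Tstar)
    <= 5 / 8 * (lam * nuc (X - Tstar)) + 5 / 4 * (lam * h).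
Proof.
move=> tv ST SX; have t0 := tau_gt0; have v0 := v_gt0; have a0 := alpha_gt0.
have vt0 : 0 <= v + tau by lra.
have M_bound (C : 'M[R]_(m, n)) :
    `|v * inner C C - inner (G *m C) C| <= (v + tau) * inner C C.
  have := Q_ge C; have := Q_le C; have C0 := inner_ge0 C.
  have := mulr_ge0 (ltW a0) C0; have := mulr_ge0 (ltW v0) C0.
  by rewrite ler_norml; move=> ? ? ? ?; apply/andP; split; lra.
have := bilinear_cauchy G_sym vt0 M_bound (nuclear_norm_ge0 (T - Tstar))
  (nuclear_norm_ge0 (X - Tstar)) (inner_le_nuclear_sqr _) (inner_le_nuclear_sqr _).
have dT := le_trans (nuclear_normB T Tstar) (lerD ST (lexx _)).
have N0 := nuclear_norm_ge0 (X - Tstar); have NX := nuclear_ball_diam SX Tstar_in.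
have P0 := nuclear_norm_ge0 Tstar.
have h1 := ler_wpM2r N0 (ler_wpM2l vt0 dT).
move: (nuc (X - Tstar)) N0 NX h1 => N N0 NX h1 /le_trans; apply.
apply: le_trans h1 _.
have w0 : 0 <= omega by apply: le_trans (nuclear_norm_ge0 T) ST.
have h2 : (v + tau) * (omega + nuc Tstar) * N <= 5 / 2 * tau * (omega + nuc Tstar) * N.
  by rewrite ler_wpM2r // ler_wpM2r ?addr_ge0 //; lra.
have h3 := ler_wpM2r N0 tau_rate; have h4 := ler_wpM2r N0 rate_lam.
have h5 := ler_wpM2l P0 (ler_wpM2l (ltW t0) NX).
have h6 := ler_wpM2l P0 tau_rate; have h7 := ler_wpM2l P0 rate_lam.
have h8 := ler_wpM2l (ltW lam_gt0) Tstar_small.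
lra.
Qed.

(** Test the optimality of X against Tstar itself.  Noise costs 1/4 and
    [overstep_cross] 5/8 of lam nuc (X - Tstar), which leaves 1/8 against
    13/4 lam h, whence the factor 26. *)
Lemma overstep_target T X : 2 * v <= 3 * tau -> S T ->
    is_argmin S (prox_objective G Ups lam v T) X ->
  nuc (X - Tstar) <= 26 * h /\ Psi X - Psi That <= 26 * (lam * h).
Proof.
move=> tv ST opt; have SX := opt.1.
have vi := prox_first_order lam_gt0 v_gt0 opt Tstar_in.
have gE : grad_loss G Ups T = G *m (T - Tstar) - (Ups - G *m Tstar).
  by rewrite /grad_loss mulmxBr opprB addrA subrK.
have XE := objective_starE X; have n1 := noise_le (X - Tstar).
have n2 := ler_wpM2l (ltW lam_gt0) (nuclear_normB X Tstar).
have hu := tau_inner_le SX Tstar_in; have hQ := Q_le (X - Tstar).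
have hstar := objective_star_le; have cross := overstep_cross tv ST SX.
have hs := ler_wpM2l (ltW lam_gt0) Tstar_small.
have vu := mulr_ge0 (ltW v_gt0) (inner_ge0 (X - Tstar)).
have dX : X - T = (X - Tstar) - (T - Tstar) by rewrite opprB addrA subrK.
move: vi; rewrite gE dX -(opprB X Tstar).
move: (X - Tstar) (T - Tstar) (Ups - G *m Tstar) XE n1 n2 hu hQ cross vu.
move=> u D W XE n1 n2 hu hQ cross vu.
rewrite innerNr !(innerDl, innerNl) innerNr => vi.
have far : lam * nuc u <= 26 * (lam * h) by lra.
split; last by lra.
by rewrite -(ler_pM2l lam_gt0); lra.
Qed.

(** From a gap above 27 lam h, the new gap is at most 26 lam h <= (1 - b) 27 lam h.
    Below, T, X and That are all within a multiple of h of each other and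
    [coarse_descent] with a = 8 b = alpha / v leaves an error of order tau h^2. *)
Lemma overstep_contraction T X : 2 * v <= 3 * tau -> S T ->
    is_argmin S (prox_objective G Ups lam v T) X ->
  Psi X - Psi That <= Num.max floor ((1 - b) * (Psi T - Psi That)).
Proof.
move=> tv ST opt; have [Xu gX] := overstep_target tv ST opt.
have a0 : 0 <= 8 * b by have := b_gt0; lra.
have a1 : 8 * b <= 1 by have := b_le; lra.
have step := coarse_descent ST opt a0 a1.
have g0 := gap_ge0 ST; have hN := nuclear_hat_le_gap ST.
have hT := nuclear_star_le_gap ST.
have [far|near] := leP (27 * (lam * h)) (Psi T - Psi That).
  rewrite le_max; apply/orP; right.
  have := ler_wpM2r g0 b_le; have := h_ge0; lra.
have N1 : nuc (T - That) <= 62 * h by rewrite -(ler_pM2l lam_gt0); lra.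
have N2 : nuc (X - T) <= 84 * h.
  have -> : X - T = (X - Tstar) - (T - Tstar) by rewrite opprB addrA subrK.
  apply: le_trans (nuclear_normB _ _) _.
  have : nuc (T - Tstar) <= 58 * h by rewrite -(ler_pM2l lam_gt0); lra.
  lra.
have sq (C : 'M[R]_(m, n)) (k : R) : 0 <= k -> nuc C <= k * h ->
     inner C C <= k ^+ 2 * h ^+ 2.
  move=> k0 Ck; apply: le_trans (inner_le_nuclear_sqr C) _.
  by rewrite -exprMn ler_sqr ?nnegrE ?nuclear_norm_ge0 ?mulr_ge0.
have I1 := ler_wpM2l (ltW tau_gt0) (sq _ _ (ler0n _ 62) N1).
have I2 := ler_wpM2l (ltW tau_gt0) (sq _ _ (ler0n _ 84) N2).
have th0 : 0 <= tau * h ^+ 2 by rewrite mulr_ge0 ?sqr_ge0 // ltW.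
have I0 := mulr_ge0 (ltW tau_gt0) (inner_ge0 (T - That)).
have c_gt : b < 8 * b by have := b_gt0; lra.
have e0 : 0 <= 4010 * (tau * h ^+ 2) by rewrite mulr_ge0.
have step' : Psi X - Psi That
    <= (1 - 8 * b) * (Psi T - Psi That) + 4010 * (tau * h ^+ 2).
  apply: le_trans step _; rewrite -addrA lerD2l.
  rewrite (_ : 8 * b / 2 * (8 * b * v - alpha + tau) * inner (T - That) (T - That)
     = 4 * b * (tau * inner (T - That) (T - That))); last by rewrite alphaE; field.
  have := ler_wpM2r I0 b_le; lra.
apply: le_trans (affine_recursion c_gt a1 e0 step') _.
rewrite ge_max !le_max lexx orbT andbT; apply/orP; left.
have -> : 4010 * (tau * h ^+ 2) / (8 * b - b) = 4010 / 7 * tau * h ^+ 2 / b.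
  by field; apply/andP; split; rewrite gt_eqF //; have := b_gt0; lra.
by rewrite ler_wpM2r ?invr_ge0 ?(ltW b_gt0) //; lra.
Qed.

End SmallTarget.
End Contraction.

(** * Iteration count *)

Section Recursion.
Context {R : realType}.

(** The maximum is preserved because kap delta <= delta. *)
Lemma geometric_floor (g : nat -> R) (delta kap : R) :
    0 <= kap -> kap <= 1 -> 0 <= delta ->
    (forall t, g t.+1 <= Num.max delta (kap * g t)) ->
  forall t, g t <= Num.max delta (kap ^+ t * g 0%N).
Proof.
move=> k0 k1 d0 step; elim=> [|t IH]; first by rewrite expr0 mul1r le_max lexx orbT.
apply: le_trans (step t) _; rewrite ge_max le_max lexx /=.
apply: le_trans (ler_wpM2l k0 IH) _.
rewrite maxr_pMr // exprS mulrA ge_max !le_max lexx orbT andbT.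
by apply/orP; left; rewrite ler_piMl.
Qed.

(** The double-logarithmic summand is nonnegative, so t exceeds the other one,
    ln (gap / delta) / ln (1 / kap); a nonpositive gap is already below delta. *)
Lemma iter_bound_reached (omega lam kap gap delta : R) t :
    0 < kap -> kap < 1 -> 0 < delta ->
    iter_bound omega lam kap gap delta <= t%:R ->
  kap ^+ t * gap <= delta.
Proof.
move=> k0 k1 d0; rewrite /iter_bound => ht.
have [gap0|gap0] := leP gap 0.
  by apply: le_trans (ltW d0); rewrite mulr_ge0_le0 // exprn_ge0 // ltW.
have L0 : 0 < ln (1 / kap) by rewrite ln_gt0 // ltr_pdivlMr // mul1r.
have warm : 0 <= Num.max 0 (log2 (log2 (omega * lam / delta)))
    * (1 + ln 2 / ln (1 / kap)).
  rewrite mulr_ge0 // ?le_max ?lexx // addr_ge0 // divr_ge0 ?(ltW L0) //.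
  by rewrite ln_ge0 // ler1n.
have : ln (gap / delta) / ln (1 / kap) <= t%:R by lra.
rewrite ler_pdivrMr // mulr_natl -lnXn ?divr_gt0 //.
rewrite ler_ln ?posrE ?exprn_gt0 ?divr_gt0 // div1r exprVn.
by rewrite ler_pdivrMr // mulrC ler_pdivlMr ?exprn_gt0 // mulrC.
Qed.

End Recursion.

(** * The statistical constants *)

Section Constants.
Context {R : realType}.

(** For q > 0 every singular value s satisfies s^q <= Rq < lam^q, so s <= lam and
    s = s^q s^(1-q) <= s^q lam^(1-q).  For q = 0 the rank is less than one. *)
Lemma schatten_ball_nuclear m n (q Rq lam : R) (A : 'M[R]_(m, n)) :
    0 <= q -> q <= 1 -> 0 < lam -> schatten_ball q Rq A ->
    lam `^ (- q) * Rq < 1 ->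
  nuclear_norm A <= lam * (lam `^ (- q) * Rq).
Proof.
move=> q0 q1 l0; rewrite /schatten_ball; have [->|qn0] := eqVneq q 0.
  rewrite oppr0 powRr0 mul1r => rk R1.
  have A0 : A = 0.
    by apply/eqP; rewrite -mxrank_eq0 -leqn0 -ltnS -(ltr_nat R) (le_lt_trans rk).
  have := nuclear_norm_convex A A (lexx 0) (lexx 0).
  rewrite scale0r addr0 !mul0r addr0 A0 => /le_trans; apply.
  rewrite mulr_ge0 ?(ltW l0) //; apply: le_trans rk; exact: ler0n.
have qp : 0 < q by rewrite lt_def qn0.
have lq : 0 < lam `^ q by rewrite powR_gt0.
rewrite powRN => ball; rewrite mulrC ltr_pdivrMr // mul1r => small.
pose s (j : 'I_(minn m n)) : R := (sing_vals A)`_j.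
have s0 j : 0 <= s j by have /andP[] := sing_vals_bounds A (ltn_ord j).
have sq_le j : s j `^ q <= Rq.
  apply: le_trans ball; rewrite (bigD1 j) //= -/(s j) (ger0_norm (s0 j)) lerDl.
  by rewrite sumr_ge0 // => i _; rewrite powR_ge0.
have s_lam j : s j <= lam.
  rewrite leNgt; apply/negP => lt_s.
  have := gt0_ltr_powR qp; rewrite /= => /(_ lam (s j)).
  rewrite !nnegrE ltW // s0 => /(_ isT isT lt_s) h.
  by have := lt_le_trans h (sq_le j); rewrite ltNge (ltW small).
have term j : s j <= (lam / lam `^ q) * (s j `^ q).
  have [->|sn0] := eqVneq (s j) 0.
    by rewrite powR0 // ?gt_eqF // mulr0.
  have sp : 0 < s j by rewrite lt_def sn0 s0.
  have split (x : R) : 0 < x -> x = x `^ q * x `^ (1 - q).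
    move=> x0; rewrite -powRD; last by rewrite (gt_eqF x0) implybT.
    by rewrite [q + _]addrC subrK powRr1 // ltW.
  rewrite {1}(split _ sp) mulrC ler_wpM2r ?powR_ge0 //.
  have -> : lam / lam `^ q = lam `^ (1 - q).
    by rewrite {1}(split _ l0); field; rewrite gt_eqF.
  by rewrite ge0_ler_powR ?nnegrE ?subr_ge0 // ltW.
rewrite /nuclear_norm mulrCA [Rq * _]mulrC.
apply: le_trans (ler_sum _ (fun j _ => term j)) _.
rewrite -mulr_sumr ler_wpM2l ?divr_ge0 ?(ltW l0) ?(ltW lq) //.
apply: le_trans ball; apply: ler_sum => j _; by rewrite -/(s j) ger0_norm.
Qed.

(** The numerator of kappa exceeds 1 - b > 0, where b = alpha / (8 v), so positivity
    of kappa makes the common denominator 1 - y positive; as y > 0, dividing by it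
    only increases.  Then kappa < 1 reads x + y < b, and x is the quantity to bound. *)
Lemma kappa_bounds (q Rq lam tau alpha v : R) :
    0 < Rq -> 0 < lam -> 0 < tau -> 0 < alpha -> 4 * alpha <= v ->
    0 < kappa q Rq lam tau alpha v -> kappa q Rq lam tau alpha v < 1 ->
  [/\ 1 - alpha / (8 * v) <= kappa q Rq lam tau alpha v,
      256 * tau * (lam `^ (- q) * Rq) <= alpha / (8 * v) * alpha &
      5 * tau <= xi q Rq lam tau alpha v].
Proof.
move=> R0 l0 t0 a0 av; rewrite /kappa /xi.
have v0 : 0 < v by lra.
set b := alpha / (8 * v).
have b0 : 0 < b by rewrite divr_gt0 // mulr_gt0.
have b1 : b <= 32^-1 by rewrite ler_pdivrMr ?mulr_gt0 //; lra.
have -> : 256 * tau * lam `^ (- q) * Rq / alpha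
        = 256 * tau * (lam `^ (- q) * Rq) / alpha by rewrite !mulrA.
set x := 256 * tau * (lam `^ (- q) * Rq) / alpha.
set y := 256 * tau * lam `^ (- (q / 2)) * Rq / alpha.
set z := 512 * tau * lam `^ (q / 2) * Rq / alpha.
have x0 : 0 < x by rewrite divr_gt0 // !mulr_gt0 // powR_gt0.
have y0 : 0 < y by rewrite divr_gt0 // !mulr_gt0 // powR_gt0.
have z0 : 0 < z by rewrite divr_gt0 // !mulr_gt0 // powR_gt0.
have num0 : 0 < 1 - b + x by lra.
rewrite pmulr_rgt0 // invr_gt0 => den0; rewrite ltr_pdivrMr // => num_lt.
split.
- rewrite ler_pdivlMr //; apply: le_trans (_ : (1 - b) * 1 <= _); last by lra.
  by rewrite ler_wpM2l //; lra.
- by rewrite -ler_pdivrMr // -/x; lra.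
- rewrite ler_pdivlMr //; apply: le_trans (_ : 5 * tau * 1 <= _).
    by rewrite ler_wpM2l //; lra.
  by have := mulr_gt0 t0 z0; have := mulr_gt0 t0 b0; lra.
Qed.

(** This is eps_stat at err = 0: the powers of lam and the roots of Rq recombine. *)
Lemma eps_stat_ge (q Rq lam err : R) : 0 < Rq -> 0 < lam -> 0 <= err ->
  8 * (lam * (lam `^ (- q) * Rq)) <= eps_stat q Rq lam err.
Proof.
move=> R0 l0 e0; rewrite /eps_stat.
have sR : Num.sqrt Rq * Num.sqrt Rq = Rq by rewrite -expr2 sqr_sqrtr // ltW.
have -> : 8 * (lam * (lam `^ (- q) * Rq))
   = 8 * lam `^ (- (q / 2)) * Num.sqrt Rq * (lam `^ (1 - q / 2) * Num.sqrt Rq).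
  rewrite -{1}sR -{1}(powRr1 (ltW l0)).
  have pD r s : lam `^ r * lam `^ s = lam `^ (r + s).
    by rewrite powRD // (gt_eqF l0) implybT.
  rewrite (mulrA (lam `^ 1)) pD.
  rewrite (_ : 1 + - q = - (q / 2) + (1 - q / 2)); last by field.
  by rewrite -pD; ring.
rewrite ler_wpM2l ?lerDr ?mulr_ge0 ?powR_ge0 ?sqrtr_ge0 //.
Qed.

End Constants.

Theorem theorem2 (R : realType) (n d1 d2 : nat)
    (hn : (0 < n)%N) (hd1 : (0 < d1)%N) (hd2 : (0 < d2)%N)
    (q Rq omega phi lam alpha1 alpha2 tau v : R)
    (Gam : 'M[R]_d1) (Ups Theta_star Theta_hat : 'M[R]_(d1, d2))
    (Theta : nat -> 'M[R]_(d1, d2)) :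
  let rate := phi * Num.sqrt ((maxn d1 d2)%:R / n%:R) in
  let S := @nuclear_ball R d1 d2 omega in
  let Psi := objective Gam Ups lam in
  let eps := eps_stat q Rq lam (frob_norm (Theta_hat - Theta_star)) in
  let kap := kappa q Rq lam tau alpha1 v in
  let xi_ := xi q Rq lam tau alpha1 v in
  0 <= q -> q <= 1 -> 0 < Rq -> 0 < omega -> 0 < lam ->
  0 < alpha1 -> 0 < alpha2 -> 0 < tau ->
  Gam^T = Gam ->
  op_norm (Ups - Gam *m Theta_star) <= rate ->
  schatten_ball q Rq Theta_star -> S Theta_star ->
  is_argmin S Psi Theta_hat ->
  restricted_strong_convexity d2 Gam alpha1 tau ->
  restricted_strong_smoothness d2 Gam alpha2 tau ->
  tau <= phi / omega * Num.sqrt ((maxn d1 d2)%:R / n%:R) ->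
  Num.max (4 * alpha1) alpha2 <= v ->
  S (Theta 0%N) ->
  (forall t : nat,
     is_argmin S (prox_objective Gam Ups lam v (Theta t)) (Theta t.+1)) ->
  root_le q (128 * tau * Rq / alpha1) lam -> 4 * rate <= lam ->
  0 < kap -> kap < 1 ->
  forall (delta : R) (t : nat),
    8 * xi_ / (1 - kap) * eps ^+ 2 <= delta ->
    iter_bound omega lam kap (Psi (Theta 0%N) - Psi Theta_hat) delta <= t%:R ->
    frob_norm (Theta t - Theta_hat) ^+ 2
      <= 4 / alpha1 * (delta + delta ^+ 2 / (2 * tau * omega ^+ 2)
                       + 2 * tau * eps ^+ 2).
Proof.
move=> rate S Psi eps kap xi_ q0 q1 R0 w0 l0 a0 _ t0 GT dev ball Sstar opt
  rsc rss tau_le v_ge S0 step _ rate_lam k0 k1 delta t delta_ge reached.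
have [v_a1 v_a2] : 4 * alpha1 <= v /\ alpha2 <= v.
  by move: v_ge; rewrite ge_max => /andP.
have v0 : 0 < v by lra.
have tau_rate : tau * omega <= rate.
  by rewrite /rate -ler_pdivlMr // mulrAC.
have Q_ge D := restricted_convexity_spectrum D (ltW t0) rsc.
have Q_le (D : 'M[R]_(d1, d2)) : inner (Gam *m D) D <= (v + tau) * inner D D.
  apply: le_trans (restricted_smoothness_spectrum D (ltW t0) rss) _.
  by rewrite ler_wpM2r ?inner_ge0 // lerD2r.
have [kap_ge s2_le xi_ge] := kappa_bounds R0 l0 t0 a0 v_a1 k0 k1.
rewrite -/kap in kap_ge; rewrite -/xi_ in xi_ge.
pose b := alpha1 / (8 * v).
rewrite -/b in kap_ge s2_le.
have b0 : 0 < b by rewrite divr_gt0 // mulr_gt0.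
have b1 : b <= 32^-1 by rewrite ler_pdivrMr ?mulr_gt0 //; lra.
have alphaE : alpha1 = 8 * b * v by rewrite /b; field; rewrite gt_eqF.
pose s2 := lam `^ (- q) * Rq; rewrite -/s2 in s2_le.
have s2_gt0 : 0 < s2 by rewrite mulr_gt0 // powR_gt0.
pose h := lam * s2.
have h0 : 0 < h by rewrite mulr_gt0.
have eps_ge : 8 * h <= eps by rewrite /eps eps_stat_ge // sqrtr_ge0.
have ST u : S (Theta u) by case: u => // u; case: (step u).
have eps2 : 64 * h ^+ 2 <= eps ^+ 2.
  have h8 : 0 <= 8 * h by rewrite mulr_ge0 // ltW.
  have := ler_pM h8 h8 eps_ge eps_ge; rewrite -!expr2 exprMn; lra.
(* xi >= 5 tau, 1 - kappa <= b and eps >= 8 h; 2560 = 8 * 5 * 64 *)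
have floor_le : 2560 * tau * h ^+ 2 / b <= delta.
  apply: le_trans delta_ge; apply: (@le_trans _ _ (8 * (5 * tau) / b * (64 * h ^+ 2))).
    by rewrite le_eqVlt; apply/orP; left; apply/eqP; field; rewrite gt_eqF.
  apply: ler_pM => //.
  - by rewrite !mulr_ge0 ?invr_ge0 // ltW.
  - by rewrite mulr_ge0 // sqr_ge0.
  apply: ler_pM.
  - by rewrite !mulr_ge0 // ltW.
  - by rewrite invr_ge0 ltW.
  - by rewrite ler_wpM2l.
  - by rewrite lef_pV2 ?posrE ?subr_gt0 //; lra.
have delta0 : 0 < delta.
  apply: lt_le_trans floor_le; apply: divr_gt0 => //.
  by apply: mulr_gt0 (exprn_gt0 2 h0); rewrite mulr_gt0.
have eps2_0 : 0 <= eps ^+ 2 by exact: sqr_ge0.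
have d2_0 : 0 <= delta ^+ 2 / (2 * tau * omega ^+ 2).
  by rewrite divr_ge0 ?sqr_ge0 // !mulr_ge0 ?sqr_ge0 // ltW.
have te0 : 0 <= 2 * tau * eps ^+ 2 by rewrite mulr_ge0 // mulr_ge0 // ltW.
pose gap u := Psi (Theta u) - Psi Theta_hat.
have gap0 u : 0 <= gap u by exact: gap_ge0 opt _ (ST u).
have bkap u : (1 - b) * gap u <= kap * gap u by rewrite ler_wpM2r.
have finish : (forall u, gap u.+1 <= Num.max delta (kap * gap u)) -> gap t <= delta.
  move=> rec; have := geometric_floor (ltW k0) (ltW k1) (ltW delta0) rec t.
  move/le_trans; apply; rewrite ge_max lexx /=.
  exact: iter_bound_reached reached.
rewrite frob_norm_sqr mulrC -ler_pdivrMr ?divr_gt0 // invf_div mulrC.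
have [weak|strong] := leP (2 * tau) alpha1.
  have gt : gap t <= delta.
    apply: finish => u; rewrite le_max; apply/orP; right.
    apply: le_trans (bkap u).
    exact: (strongly_convex_contraction GT l0 v0 t0 b0 b1 alphaE Q_ge Q_le opt
      weak (ST u) (step u)).
  have := strongly_convex_error GT l0 Q_ge opt weak (ST t); rewrite -/(gap t); lra.
(* here tau > alpha1 / 2, so 128 alpha1 s2 < 256 tau s2 <= b alpha1 <= alpha1 / 32 *)
have s2_1 : s2 < 1.
  have := ler_wpM2r (ltW a0) b1; have := ltr_pM2r s2_gt0; nra.
have small : nuclear_norm Theta_star <= h by exact: schatten_ball_nuclear ball s2_1.
have noise : op_bounded rate (Ups - Gam *m Theta_star).
  move=> x y; apply: le_trans (op_norm_bounded _ x y) _.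
  by rewrite ler_wpM2r ?addr_ge0 ?inner_ge0.
have gt : gap t <= delta.
  apply: finish => u.
  apply: (@le_trans _ _ (Num.max (2560 * tau * h ^+ 2 / b) ((1 - b) * gap u))).
    have [tv|tv] := leP (3 * tau) (2 * v).
      exact: (moderate_contraction GT l0 v0 t0 b0 b1 alphaE Q_ge Q_le opt
        Sstar small noise tau_rate rate_lam tv (ST u) (step u)).
    exact: (overstep_contraction GT l0 v0 t0 b0 b1 alphaE Q_ge Q_le opt
      Sstar small noise tau_rate rate_lam (ltW tv) (ST u) (step u)).
  by rewrite ge_max !le_max floor_le /= bkap orbT.
have := floor_error GT l0 t0 Q_ge opt (ST t).
have hN := nuclear_hat_le_gap GT l0 v0 t0 b0 alphaE Q_ge opt
  Sstar small noise tau_rate rate_lam (ST t).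
move: (nuclear_norm_ge0 (Theta t - Theta_hat)) hN.
rewrite -/Psi -/(gap t); move: (nuclear_norm _) => N N0 hN err.
have Nle : N <= 2 * delta / lam + eps.
  rewrite -(ler_pM2l l0) mulrDr (mulrC lam (_ / _)) divfK ?gt_eqF //.
  have := ler_wpM2l (ltW l0) eps_ge; lra.
have N2 : N ^+ 2 <= 8 * (delta / lam) ^+ 2 + 2 * eps ^+ 2.
  have := ler_pM N0 N0 Nle Nle; have := sqr_ge0 (2 * (delta / lam) - eps).
  rewrite -!expr2; lra.
have tN := ler_wpM2l (ltW t0) N2.
have lam_ge : 4 * (tau * omega) <= lam by lra.
(* 16 tau^2 omega^2 <= lam^2 turns the gap term into one free of lam *)
have tail : 4 * tau * (delta / lam) ^+ 2 <= delta ^+ 2 / (2 * tau * omega ^+ 2).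
  have den0 : 0 < 2 * tau * omega ^+ 2.
    by apply: mulr_gt0 (exprn_gt0 2 w0); rewrite mulr_gt0.
  have to0 : 0 <= 4 * (tau * omega) by apply: mulr_ge0 => //; rewrite mulr_ge0 // ltW.
  have := ler_pM to0 to0 lam_ge lam_ge => /(ler_wpM2l (sqr_ge0 (delta / lam))) sq.
  have dE : (delta / lam) ^+ 2 * (lam * lam) = delta ^+ 2 by field; rewrite gt_eqF.
  rewrite ler_pdivlMr //; move: sq; rewrite dE.
  have := mulr_ge0 (sqr_ge0 (delta / lam)) (sqr_ge0 (tau * omega)); lra.
lra.
Qed.
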